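(* Let $\mathbf{A}\in\mathbb{C}^{n\times n}$ be Hermitian with $\|\mathbf{A}\|\le1$ and eigenvalues $\lambda_1\le\dots\le\lambda_n$, let $\epsilon\in(0,1)$ and $k\in[n-1]$, and set $\mu_k=\frac{\lambda_k+\lambda_{k+1}}2$, $\mathrm{gap}_k=|\lambda_k-\lambda_{k+1}|$. Algorithm $\mathsf{FERMI}(\mathbf{A},\epsilon,k)$: set $\delta=1/2$, compute $(\widetilde\lambda_1,\dots,\widetilde\lambda_n)=\mathsf{EVALSH}(\mathbf{A},\delta)$ (listed in nondecreasing order) and $\widetilde{\mathrm{gap}}_k=|\widetilde\lambda_k-\widetilde\lambda_{k+1}|$; while $\delta>\frac{\epsilon}{1+2\epsilon}\widetilde{\mathrm{gap}}_k$, set $\delta\leftarrow\delta/2$ and recompute the $\widetilde\lambda_i=\mathsf{EVALSH}(\mathbf{A},\delta)$ and $\widetilde{\mathrm{gap}}_k$; return $\widetilde\mu_k=\frac{\widetilde\lambda_k+\widetilde\lambda_{k+1}}2$ and $\widetilde{\mathrm{gap}}_k$. Then: (i) on success, $|\mu_k-\widetilde\mu_k|\le\epsilon\,\mathrm{gap}_k$ and $|\mathrm{gap}_k-\widetilde{\mathrm{gap}}_k|\le2\epsilon\,\mathrm{gap}_k$; (ii) the arithmetic complexity is $O\big(T_{\mathsf{MM}}(n)\log^2(\tfrac{n}{\epsilon\mathrm{gap}_k})\log(\tfrac1{\epsilon\mathrm{gap}_k})\big)$; (iii) it succeeds with probability at least $1-O\big(\log(1/(\epsilon\,\mathrm{gap}_k))/n\big)$;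 (iv) it requires $O\big(\log^4(\tfrac{n}{\epsilon\mathrm{gap}_k})\log n\big)$ bits of precision.
   Context: Floating point model with unit roundoff $\mathbf{u}$. $T_{\mathsf{MM}}(n)=O(n^{\omega+\eta})$ is the cost of stable fast matrix multiplication. $\mathsf{EVALSH}(\mathbf{A},\delta)$ is a randomized algorithm which, for Hermitian $\mathbf{A}$ with $\|\mathbf{A}\|\le1$ and accuracy $\delta$, returns $n$ real values which, listed in nondecreasing order, are each within $\delta$ of the correspondingly ordered eigenvalues of $\mathbf{A}$, with probability at least $1-17/n$, using $O(T_{\mathsf{MM}}(n)\log^2(n/\delta))$ arithmetic operations and $O(\log^4(n/\delta)\log n)$ bits of precision.
   Formalization: In (ii)–(iv) gap_k>0 and the logs of 1/(ε gap_k) and n/(ε gap_k) are replaced by their maximum with 1 (they vanish or are negative when ε gap_k≥1); (ii) is claimed on success, since otherwise the loop may not stop; T_MM(n)≥n² is assumed, and FERMI's own scalar steps are exact. *)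

(* Defs.v *)
From HB Require Import structures.
From mathcomp Require Import all_boot all_order all_algebra.
From mathcomp Require Import sesquilinear spectral.
From mathcomp Require Import all_classical all_reals all_analysis.
From mathcomp Require Import complex.

Set Implicit Arguments.
Unset Strict Implicit.
Unset Printing Implicit Defensive.

Import Order.TTheory GRing.Theory Num.Theory.
Import numFieldNormedType.Exports.

Local Open Scope classical_set_scope.
Local Open Scope ring_scope.

Section LinearAlgebra.
Variable R : realType.

Definition l2norm n (x : 'cV[R[i]]_n) : R :=
  Num.sqrt (\sum_i ComplexField.Normc.normc (x i 0) ^+ 2).

Definition opnorm n (A : 'M[R[i]]_n) : R :=
  sup [set l2norm (A *m x) | x in [set x : 'cV[R[i]]_n | l2norm x = 1]].

(* [lam] lists the eigenvalues with multiplicity, in nondecreasing order. *)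
Definition eigenvalues n (A : 'M[R[i]]_n) (lam : n.-tuple R) : Prop :=
  sorted <=%R lam /\ char_poly A = \prod_(a <- lam) ('X - (a%:C)%C%:P).

(* In both definitions [k] is 1-based, while sequences are indexed from 0. *)
Definition level_gap (s : seq R) (k : nat) : R := `|s`_k.-1 - s`_k|.
Definition level_mid (s : seq R) (k : nat) : R := (s`_k.-1 + s`_k) / 2.

End LinearAlgebra.

Section MatrixMultiplication.
Variable R : realType.

(* n x n complex matrices can be multiplied by a bilinear algorithm with r
   essential multiplications; X |-> \tr (f *m X) is a general linear form. *)
Definition bilinear_mm (n r : nat) : Prop :=
  exists f g w : 'I_r -> 'M[R[i]]_n, forall X Y : 'M[R[i]]_n,
    X *m Y = \sum_l (\tr (f l *m X) * \tr (g l *m Y)) *: w l.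

(* The exponent omega of complex matrix multiplication. *)
Definition mm_exponent : R :=
  inf [set t : R | exists c : R, forall n, (0 < n)%N ->
         exists2 r, bilinear_mm n r & r%:R <= c * n%:R `^ t].

(* The first clause holds because a product has n^2 distinct entries, each of
   which has to be computed. *)
Definition mm_cost (eta : R) (TMM : nat -> nat) : Prop :=
  (forall n, n ^ 2 <= TMM n)%N /\
  exists c : R, forall n, (0 < n)%N ->
    (TMM n)%:R <= c * n%:R `^ (mm_exponent + eta).

End MatrixMultiplication.

(* A randomized eigenvalue routine. Its arguments are the unit roundoff of the
   arithmetic, the input matrix, the requested accuracy and the random seed;
   the values are returned in no particular order. *)
Record eig_routine (R : realType) (d : measure_display) (S : measurableType d)
    := EigRoutine {
  eig_out : forall n, R -> 'M[R[i]]_n -> R -> S -> n.-tuple R ;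
  eig_ops : forall n, R -> 'M[R[i]]_n -> R -> S -> nat ;
  measurable_eig_out : forall n u (A : 'M[R[i]]_n) delta (i : 'I_n),
    measurable_fun [set: S] (fun s => tnth (eig_out u A delta s) i)
}.

Definition accurate (R : realType) n (lam : n.-tuple R) (delta : R)
    (s : seq R) : Prop :=
  forall i : 'I_n, `|s`_i - lam`_i| <= delta.

(* The guarantees of EVALSH. Working with b bits of precision means computing
   with some unit roundoff u <= 2^-b. *)
Definition EVALSH_spec (R : realType) (TMM : nat -> nat)
    (d : measure_display) (S : measurableType d) (Q : probability S R)
    (ev : eig_routine R S) : Prop :=
  exists Cops Cbits : R, forall (n : nat) (delta : R),
    (1 < n)%N -> 0 < delta < 1 ->
    exists2 b : nat, b%:R <= Cbits * ln (n%:R / delta) ^+ 4 * ln n%:R &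
    forall (u : R) (A : 'M[R[i]]_n) (lam : n.-tuple R),
      0 < u <= 2 ^- b ->
      A \is hermsymmx -> opnorm A <= 1 -> eigenvalues A lam ->
      (forall s, (eig_ops ev u A delta s)%:R
                   <= Cops * (TMM n)%:R * ln (n%:R / delta) ^+ 2) /\
      ((1 - 17 / n%:R)%:E <=
        Q [set s | accurate lam delta (sort <=%R (eig_out ev u A delta s))])%E.

Section While.
Variables (St : Type) (guard : St -> bool) (step : St -> St).

(* [t] is one of the states in which the guard of the loop is tested. *)
Definition while_reaches (s t : St) : Prop :=
  exists m, t = iter m step s /\ forall j, (j < m)%N -> guard (iter j step s).

Definition while_returns (s t : St) : Prop :=
  while_reaches s t /\ ~~ guard t.

End While.

Section Fermi.
Variables (R : realType) (d : measure_display) (S : measurableType d).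
Variables (ev : eig_routine R S) (u : R) (n : nat) (A : 'M[R[i]]_n).
Variables (eps : R) (k : nat) (tape : nat -> S).

Record fermi_state := FermiState {
  fermi_calls : nat ;
  fermi_delta : R ;
  fermi_lam : seq R ;
  fermi_ops : nat
}.

Definition fermi_gap (st : fermi_state) : R := level_gap (fermi_lam st) k.
Definition fermi_mu (st : fermi_state) : R := level_mid (fermi_lam st) k.

(* The j-th call to EVALSH consumes the j-th seed of the tape. Besides EVALSH,
   a pass is charged the comparisons of a merge sort, one operation for halving
   delta, two for the gap, and five for evaluating the guard. *)
Definition fermi_call (calls : nat) (delta : R) (ops : nat) : fermi_state :=
  FermiState calls.+1 delta
    (sort <=%R (eig_out ev u A delta (tape calls)))
    (ops + eig_ops ev u A delta (tape calls) + n * up_log 2 n + 8)%N.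

Definition fermi_init : fermi_state := fermi_call 0%N (1 / 2) 0%N.

Definition fermi_step (st : fermi_state) : fermi_state :=
  fermi_call (fermi_calls st) (fermi_delta st / 2) (fermi_ops st).

Definition fermi_guard (st : fermi_state) : bool :=
  fermi_delta st > eps / (1 + 2 * eps) * fermi_gap st.

(* The run stops in state [st] and returns [fermi_mu st] and [fermi_gap st]. *)
Definition fermi_returns (st : fermi_state) : Prop :=
  while_returns fermi_guard fermi_step fermi_init st.

(* Two operations compute [fermi_mu] on exit. *)
Definition fermi_total_ops (st : fermi_state) : nat := (fermi_ops st + 2)%N.

(* The run succeeds when every call to EVALSH that it makes meets its accuracy
   guarantee. *)
Definition fermi_success (lam : n.-tuple R) : Prop :=
  forall st, while_reaches fermi_guard fermi_step fermi_init st ->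
    accurate lam (fermi_delta st) (fermi_lam st).

End Fermi.

(* Every seed has law [Q]. Independence of the seeds is not required, so that
   fresh independent seeds are a special case. *)
Definition random_tape (R : realType) (dT dS : measure_display)
    (T : measurableType dT) (S : measurableType dS)
    (P : probability T R) (Q : probability S R) (seed : nat -> T -> S) : Prop :=
  forall j, measurable_fun [set: T] (seed j) /\
    forall B, measurable B -> P (seed j @^-1` B) = Q B.

(* The logarithm floored at 1: log (1 / (eps * gap)) and log (n / (eps * gap))
   can be arbitrarily close to 0 or negative when eps * gap is near or above 1,
   although one call to EVALSH is always made. *)
Definition logp (R : realType) (x : R) : R := Num.max 1 (ln x).

(* Main.v *)
Require Import Defs.
From HB Require Import structures.
From mathcomp Require Import all_boot all_order all_algebra.
From mathcomp Require Import sesquilinear spectral.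
From mathcomp Require Import all_classical all_reals all_analysis.
From mathcomp Require Import complex.
From mathcomp Require Import measurable_realfun ring lra.

Import Order.TTheory GRing.Theory Num.Theory.
Import numFieldNormedType.Exports.

Local Open Scope classical_set_scope.
Local Open Scope ring_scope.

Set Implicit Arguments.
Unset Strict Implicit.
Unset Printing Implicit Defensive.

(** Every call of EVALSH at accuracy [delta] perturbs the gap by at most
    [2 * delta]. Hence the loop can only stop once [delta <= eps * gap], which
    gives the error bounds, and can only continue while
    [5 * delta > eps * gap], so that at most logarithmically many accuracies
    [2 ^- m.+1], all at least [eps * gap / 10], are ever requested. Cost and
    precision are then bounded call by call, and the failure probability by a
    union bound over these calls. The bound [opnorm A <= 1] enters through
    [gap <= 2]: it keeps the very first accuracy [1 / 2] comparable with
    [eps * gap]. *)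

(** * Eigenvalues are bounded by the operator norm *)

Lemma normc_real (R : realType) (a : R) :
  ComplexField.Normc.normc (a%:C)%C = `|a|.
Proof. by rewrite /= expr0n addr0 sqrtr_sqr. Qed.

Lemma normc_ge0 (R : realType) (z : R[i]) : 0 <= ComplexField.Normc.normc z.
Proof. by case: z => a b; rewrite /= sqrtr_ge0. Qed.

Lemma l2normZ (R : realType) n (a : R) (x : 'cV[R[i]]_n) :
  l2norm ((a%:C)%C *: x) = `|a| * l2norm x.
Proof.
rewrite /l2norm -[`|a|]sqrtr_sqr -sqrtrM ?sqr_ge0// mulr_sumr.
congr Num.sqrt; apply: eq_bigr => i _.
by rewrite !mxE ComplexField.Normc.normcM normc_real exprMn real_normK ?num_real.
Qed.

Lemma l2norm_gt0 (R : realType) n (x : 'cV[R[i]]_n) : x != 0 -> 0 < l2norm x.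
Proof.
move=> x0; rewrite /l2norm sqrtr_gt0 lt_def sumr_ge0 ?andbT; last first.
  by move=> i _; exact: sqr_ge0.
apply: contra x0; rewrite psumr_eq0 => [/allP x0|i _]; last exact: sqr_ge0.
apply/eqP/matrixP => i j; rewrite ord1 mxE.
have := x0 i (mem_index_enum _); rewrite /= sqrf_eq0 => /eqP.
exact: ComplexField.Normc.eq0_normc.
Qed.

Lemma normc_le_l2norm (R : realType) n (x : 'cV[R[i]]_n) i :
  ComplexField.Normc.normc (x i 0) <= l2norm x.
Proof.
rewrite -[leLHS]ger0_norm ?normc_ge0// -sqrtr_sqr; apply: ler_wsqrtr.
by rewrite (bigD1 i)//= lerDl sumr_ge0// => j _; exact: sqr_ge0.
Qed.

(** A crude bound by the absolute row sums of [A] is enough: it makes the [sup] in [opnorm] a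
    genuine upper bound. *)
Lemma l2norm_mulmx_bounded (R : realType) n (A : 'M[R[i]]_n) :
  has_ubound [set l2norm (A *m x) | x in [set x : 'cV[R[i]]_n | l2norm x = 1]].
Proof.
exists (Num.sqrt (\sum_i (\sum_j ComplexField.Normc.normc (A i j)) ^+ 2)).
move=> _ [x /= x1 <-]; apply: ler_wsqrtr; apply: ler_sum => i _.
rewrite ler_sqr ?nnegrE ?normc_ge0 ?sumr_ge0//; last by move=> *; exact: normc_ge0.
rewrite mxE; elim/big_ind2 : _ => [|u a v b ua vb|j _].
- by rewrite ComplexField.Normc.normc0.
- exact: (le_trans (le_normcD _ _) (lerD ua vb)).
- rewrite ComplexField.Normc.normcM ler_piMr ?normc_ge0// -x1.
  exact: normc_le_l2norm.
Qed.

Lemma le_opnorm (R : realType) n (A : 'M[R[i]]_n) (x : 'cV[R[i]]_n) :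
  l2norm x = 1 -> l2norm (A *m x) <= opnorm A.
Proof.
move=> x1; have Ax : [set l2norm (A *m y) | y in [set y | l2norm y = 1]]
    (l2norm (A *m x)) by exists x.
by apply: sup_upper_bound => //; split;
  [exists (l2norm (A *m x)) | exact: l2norm_mulmx_bounded].
Qed.

Lemma char_poly_mx_tr (R : nzRingType) n (A : 'M[R]_n) :
  char_poly_mx A^T = (char_poly_mx A)^T.
Proof. by rewrite /char_poly_mx linearB/= tr_scalar_mx map_trmx. Qed.

(** A normalised eigenvector is stretched by exactly [|a|]. Since [eigenvalue] speaks of row vectors
    while [opnorm] acts on columns, the eigenvector is taken for [A^T], which has the same
    characteristic polynomial, and then transposed. *)
Lemma eigenvalue_le_opnorm (R : realType) n (A : 'M[R[i]]_n) (lam : n.-tuple R)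
    a : eigenvalues A lam -> a \in lam -> `|a| <= opnorm A.
Proof.
move=> [_ charA] alam.
have : eigenvalue A^T (a%:C)%C.
  rewrite eigenvalue_root_char /char_poly char_poly_mx_tr det_tr
    -/(char_poly A) charA -(big_map _ xpredT (fun b => 'X - b%:P)).
  by rewrite root_prod_XsubC map_f.
move=> /eigenvalueP[v vA v0]; have Av : A *m v^T = (a%:C)%C *: v^T.
  by rewrite -[A in A *m _]trmxK -trmx_mul vA linearZ.
have N0 : 0 < l2norm v^T by rewrite l2norm_gt0// trmx_eq0.
have cN1 : l2norm (((l2norm v^T)^-1%:C)%C *: v^T) = 1.
  by rewrite l2normZ gtr0_norm ?invr_gt0// mulVf// gt_eqF.
by have := le_opnorm A cN1;
  rewrite -scalemxAr Av scalerA mulrC -scalerA l2normZ cN1 mulr1.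
Qed.

(** * Order statistics and their measurability *)

Lemma nth_sort_le (R : realType) (s : seq R) i (c : R) : (i < size s)%N ->
  ((sort <=%R s)`_i <= c) = (i < count (fun x : R => (x <= c)%R) s)%N.
Proof.
move=> si; rewrite -(permP (permEl (perm_sort <=%R s))).
have so : sorted <=%R (sort <=%R s) by exact/sort_sorted/le_total.
apply/idP/idP => [|ic]; last exact: nth_count_le.
apply: contraTT; rewrite -leqNgt -ltNge => ci.
by apply: nth_count_gt => //; rewrite ci size_sort.
Qed.

(** By [nth_sort_le], the entry of rank [i] exceeds [c] exactly when at most [i] of the outputs are
    [<= c], and this count is a finite sum of indicators of measurable sets. *)
Lemma measurable_nth_sort (R : realType) (d : measure_display)
    (S : measurableType d) n (f : S -> n.-tuple R) i :
  (forall j, measurable_fun [set: S] (fun s => tnth (f s) j)) ->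
  measurable_fun [set: S] (fun s => (sort <=%R (f s))`_i).
Proof.
move=> mf; case: (ltnP i n) => [lin|lni]; last first.
  (* Beyond the length of the list, indexing returns the default [0]. *)
  rewrite (_ : (fun s => _) = cst 0)//.
  by apply/funext => s; rewrite nth_default// size_sort size_tuple.
move=> mT; apply: (measurability _ (RGenOInfty.measurableE R)) => //.
move=> _ [_ [c ->] <-]; rewrite setTI.
rewrite (_ : _ @^-1` _ =
  [set s | (\sum_(j < n) \1_[set t | tnth (f t) j <= c] s : R) <= i%:R]).
  rewrite -[X in measurable X]setTI; apply: measurable_fun_le => //.
  apply: measurable_sum => j; apply: measurable_indic.
  rewrite -[X in measurable X]setTI; apply: measurable_fun_le => //.
suff sumE s : (\sum_(j < n) \1_[set t | tnth (f t) j <= c] s : R)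
    = (count (fun x : R => (x <= c)%R) (f s))%:R.
  by apply/seteqP; split=> s /=; rewrite in_itv /= andbT ltNge nth_sort_le
    ?size_tuple// -leqNgt sumE ler_nat.
rewrite -sum1_count big_tuple natr_sum [RHS]big_mkcond/=; apply: eq_bigr => j _.
by rewrite indicE; case: ifPn => h; [rewrite mem_set | rewrite memNset//=; exact/negP].
Qed.

(** * Perturbation of the gap and what the loop guard reveals about it *)

Lemma accurate_level_gap (R : realType) n (lam : n.-tuple R) (delta : R)
    (s : seq R) k : (0 < k < n)%N -> accurate lam delta s ->
  `|level_gap lam k - level_gap s k| <= 2 * delta.
Proof.
move=> /andP[k0 kn] acc.
have := acc (Ordinal kn); have := acc (Ordinal (leq_ltn_trans (leq_pred k) kn)).
rewrite /level_gap /= => h1 h2; apply: (le_trans (ler_dist_dist _ _)).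
move: h1 h2; rewrite !ler_norml; lra.
Qed.

Lemma accurate_level_mid (R : realType) n (lam : n.-tuple R) (delta : R)
    (s : seq R) k : (0 < k < n)%N -> accurate lam delta s ->
  `|level_mid lam k - level_mid s k| <= delta.
Proof.
move=> /andP[k0 kn] acc.
have := acc (Ordinal kn); have := acc (Ordinal (leq_ltn_trans (leq_pred k) kn)).
rewrite /level_mid /= !ler_norml; lra.
Qed.

Lemma guardE (R : realType) (eps delta g : R) : 0 < eps ->
  (eps / (1 + 2 * eps) * g < delta) = (eps * g < delta * (1 + 2 * eps)).
Proof. by move=> e0; rewrite mulrAC ltr_pdivrMr//; lra. Qed.

(** Stopping means [delta * (1 + 2 * eps) <= eps * g'], and [g' <= g + 2 * delta]; the terms
    [2 * eps * delta] cancel. This is the purpose of the denominator in the guard. *)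
Lemma stop_accuracy (R : realType) (eps delta g g' : R) : 0 < eps ->
  `|g - g'| <= 2 * delta -> delta <= eps / (1 + 2 * eps) * g' ->
  delta <= eps * g.
Proof.
move=> e0; rewrite ler_norml => /andP[gg' _].
rewrite leNgt guardE// -leNgt => h.
have : eps * g' <= eps * (g + 2 * delta) by rewrite ler_pM2l//; lra.
lra.
Qed.

(** Here [g - 2 * delta <= g'] turns the guard into [eps * g < (1 + 4 * eps) * delta], and [eps < 1]
    gives the factor 5. *)
Lemma continue_accuracy (R : realType) (eps delta g g' : R) : 0 < eps < 1 ->
  `|g - g'| <= 2 * delta -> eps / (1 + 2 * eps) * g' < delta ->
  eps * g < 5 * delta.
Proof.
move=> /andP[e0 e1]; rewrite ler_norml => /andP[gg' gg''].
rewrite guardE// => h.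
have : eps * (g - 2 * delta) <= eps * g' by rewrite ler_pM2l//; lra.
have : 0 <= (1 - eps) * delta by rewrite mulr_ge0//; lra.
lra.
Qed.

(** * Logarithm estimates and the number of halvings *)

Lemma ln2_ge_half (R : realType) : 1 / 2 <= ln (2 : R).
Proof.
have -> : (2 : R) = (1 + - (1 / 2))^-1 by field.
rewrite lnV ?posrE; last lra.
have : ln (1 + - (1 / 2)) <= - (1 / 2) :> R by apply: le_ln1Dx; lra.
lra.
Qed.

Lemma ln_le_subr1 (R : realType) (x : R) : 0 < x -> ln x <= x - 1.
Proof.
by move=> x0; rewrite -[x in ln x](subrKC 1) le_ln1Dx//; lra.
Qed.

Lemma ln_natr_ge0 (R : realType) n : 0 <= ln n%:R :> R.
Proof.
case: n => [|n]; first by rewrite ln0.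
by rewrite ln_ge0// ler1n.
Qed.

Lemma logp_ge1 (R : realType) (x : R) : 1 <= logp x.
Proof. by rewrite /logp le_max lexx. Qed.

Lemma ln_le_logp (R : realType) (x : R) : ln x <= logp x.
Proof. by rewrite /logp le_max lexx orbT. Qed.

(** [M] is the least index satisfying the first inequality; minimality then gives the other two.
    With [X] standing for [eps * gap], [M] is the last call that can occur when all calls are
    accurate. *)
Lemma halving_depth (R : realType) (X : R) : 0 < X <= 2 ->
  exists M, [/\ 5 * 2 ^- M.+1 <= X, X <= 10 * 2 ^- M.+1 &
    M.+1%:R <= 11 * logp (1 / X)].
Proof.
move=> /andP[X0 X2].
have p2 m : 0 < (2 ^+ m : R) by rewrite exprn_gt0.
have exM : exists M, 5 * 2 ^- M.+1 <= X.
  have := archi_boundP (ltW (divr_gt0 (_ : 0 < 5) X0)).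
  set m := Num.bound _ => h; exists m.
  rewrite ler_pdivrMr// -ler_pdivrMl// mulrC; apply: (le_trans (ltW (h _))) => //.
  by rewrite -natrX ler_nat (leq_trans (ltnW (ltn_expl m (ltnSn 1))))// leq_exp2l.
have L1 := logp_ge1 (1 / X).
case: (ex_minnP exM) => -[|M] hM minM.
  (* At index 0 minimality says nothing; [X <= 2] takes over. *)
  by exists 0%N; split => //; [rewrite expr1|]; lra.
exists M.+1; split => //.
  have : X < 5 * 2 ^- M.+1 by rewrite ltNge; apply/negP => /minM; rewrite ltnn.
  rewrite [2 ^+ M.+2]exprS invfM; lra.
have : X < 5 * 2 ^- M.+1 by rewrite ltNge; apply/negP => /minM; rewrite ltnn.
(* Taking logarithms in [2 ^+ M.+1 < 5 / X], with [ln 2 >= 1 / 2] and [ln 5 <= 4], gives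
   [M.+2 <= 9 + 2 * logp (1 / X)]; the floor at 1 in [logp] absorbs the 9, whence 11. *)
rewrite ltr_pdivlMr// -ltr_pdivlMl// mulrC => h.
have : ln (2 ^+ M.+1) <= ln (5 / X) by rewrite ler_ln ?posrE ?divr_gt0// ltW.
rewrite lnXn// lnM ?posrE ?invr_gt0//.
rewrite -[ln 2 *+ _]mulr_natr.
have := @ln_le_subr1 R 5 ltac:(lra); have := ln_le_logp X^-1.
move: L1; rewrite mul1r.
have : 1 / 2 * M.+1%:R <= ln 2 * M.+1%:R :> R.
  by rewrite ler_wpM2r// ln2_ge_half.
rewrite -[M.+2%:R]natr1; lra.
Qed.

(** The ratio [n / delta] is at most [10 * (n / X)], and [ln 10 <= 9] is absorbed by [logp >= 1]. *)
Lemma ln_le_logpM (R : realType) (n : nat) (X delta : R) :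
  (0 < n)%N -> 0 < X -> 0 < delta -> X <= 10 * delta ->
  ln (n%:R / delta) <= 10 * logp (n%:R / X).
Proof.
move=> n0 X0 d0 Xd; have nR : 0 < n%:R :> R by rewrite ltr0n.
apply: (@le_trans _ _ (ln (10 * (n%:R / X)))).
  rewrite ler_ln ?posrE ?mulr_gt0 ?invr_gt0// mulrCA ler_pM2l//.
  by rewrite ler_pdivlMr// mulrC ler_pdivrMr.
rewrite lnM ?posrE ?divr_gt0//.
have := @ln_le_subr1 R 10 ltac:(lra); have := ln_le_logp (n%:R / X).
have := logp_ge1 (n%:R / X); lra.
Qed.

(** * Analysis of the loop along a fixed tape *)

Section FermiRun.
Variables (R : realType) (d : measure_display) (S : measurableType d).
Variables (ev : eig_routine R S) (u : R) (n : nat) (A : 'M[R[i]]_n).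
Variables (eps : R) (k : nat) (lam : n.-tuple R).

Let state (tape : nat -> S) m :=
  iter m (fermi_step ev u A tape) (fermi_init ev u A tape).

(** The accuracy of call [m] is [2 ^- m.+1] whatever the tape, so this is an event about a single
    seed, fixed before the run. Adaptive stopping therefore does not obstruct a union bound. *)
Let good m : set S :=
  [set s | accurate lam (2 ^- m.+1) (sort <=%R (eig_out ev u A (2 ^- m.+1) s))].

Lemma fermi_calls_iter tape m : fermi_calls (state tape m) = m.+1.
Proof. by elim: m => //= m ->. Qed.

Lemma fermi_delta_iter tape m : fermi_delta (state tape m) = 2 ^- m.+1.
Proof.
elim: m => [|m IH]; first by rewrite /= expr1 mul1r.
by rewrite [LHS]/= IH [in RHS]exprS invfM mulrC.
Qed.

Lemma fermi_lam_iter tape m : fermi_lam (state tape m) =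
  sort <=%R (eig_out ev u A (2 ^- m.+1) (tape m)).
Proof.
rewrite -(fermi_delta_iter tape m).
by case: m => [|m] //=; rewrite -/(state tape m) fermi_calls_iter.
Qed.

Lemma fermi_ops_iter tape (c : R) M :
  (forall j s, (j <= M)%N -> (eig_ops ev u A (2 ^- j.+1) s)%:R <= c) ->
  (fermi_ops (state tape M))%:R <= M.+1%:R * (c + (n * up_log 2 n)%:R + 8).
Proof.
elim: M => [|M IH] opsc.
  have := opsc 0%N (tape 0%N) isT.
  rewrite /= add0n !natrD expr1 div1r; lra.
have {}IH := IH (fun j s jM => opsc j s (leqW jM)).
have := opsc M.+1 (tape M.+1) (leqnn _).
rewrite /= -/(state tape M) fermi_calls_iter !natrD -(fermi_delta_iter tape M.+1) /=.
by rewrite -/(state tape M) -[M.+2%:R]natr1; lra.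
Qed.

(** Call [m] is made exactly when the guard held in all earlier states, so success becomes a
    countable family of implications. *)
Lemma fermi_successP tape : fermi_success ev u A eps k tape lam <->
  forall m, (forall j, (j < m)%N -> fermi_guard eps k (state tape j)) ->
    good m (tape m).
Proof.
split=> [succ m gm|succ _ [m [-> gm]]].
  have := succ (state tape m) (ex_intro _ m (conj erefl gm)).
  by rewrite fermi_delta_iter fermi_lam_iter.
by rewrite fermi_delta_iter fermi_lam_iter; exact: succ.
Qed.

Hypotheses (eps01 : 0 < eps < 1) (kn : (0 < k < n)%N).

Lemma fermi_returns_accurate tape st :
  fermi_success ev u A eps k tape lam -> fermi_returns ev u A eps k tape st ->
  `|level_mid lam k - fermi_mu k st| <= eps * level_gap lam k /\
  `|level_gap lam k - fermi_gap k st| <= 2 * eps * level_gap lam k.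
Proof.
move=> succ [reach]; rewrite /fermi_guard -leNgt => stop.
have acc := succ _ reach; have hg := accurate_level_gap kn acc.
have e0 : 0 < eps by case/andP: eps01.
have le := stop_accuracy e0 hg stop.
split; first exact: le_trans (accurate_level_mid kn acc) le.
by rewrite -mulrA; apply: (le_trans hg); rewrite ler_pM2l.
Qed.

Variable M : nat.
Hypothesis depthM : 5 * 2 ^- M.+1 <= eps * level_gap lam k.

(** Continuing after an accurate call [M] would contradict [depthM], by [continue_accuracy]. *)
Lemma good_stop tape : good M (tape M) -> ~~ fermi_guard eps k (state tape M).
Proof.
move=> gM; apply/negP; rewrite /fermi_guard /fermi_gap fermi_delta_iter fermi_lam_iter.
move=> /(continue_accuracy eps01 (accurate_level_gap kn gM)).
by rewrite ltNge depthM.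
Qed.

(** An accurate call [M] stops the loop there at the latest, so later seeds are never consumed. *)
Lemma good_fermi_success tape :
  (forall j, (j <= M)%N -> good j (tape j)) -> fermi_success ev u A eps k tape lam.
Proof.
move=> gd; apply/fermi_successP => m gm; apply: (gd); rewrite leqNgt.
by apply/negP => /gm; apply/negP/good_stop/gd.
Qed.

Lemma fermi_success_returns tape : fermi_success ev u A eps k tape lam ->
  exists2 m, (m <= M)%N & fermi_returns ev u A eps k tape (state tape m).
Proof.
move=> /fermi_successP succ.
have exm : exists m, ~~ fermi_guard eps k (state tape m).
  apply: contrapT => /forallNP gd; have gd' j : fermi_guard eps k (state tape j).
    by apply/negPn/negP.
  (* If the guard never failed, call [M] would be made, hence accurate by success, and the loop
     would stop at it. *)
  by have /good_stop/negP := succ M (fun j _ => gd' j); apply.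
case: (ex_minnP exm) => m stop minm.
have gm j : (j < m)%N -> fermi_guard eps k (state tape j).
  by move=> jm; apply: contraLR jm => /minm; rewrite -leqNgt.
exists m; last by split => //; exists m.
rewrite leqNgt; apply/negP => Mm.
have /good_stop := succ M (fun j jM => gm j (ltn_trans jM Mm)).
by rewrite gm.
Qed.

End FermiRun.

(** * Measurability of success, and the union bound *)

Section FermiProbability.
Variables (R : realType) (d : measure_display) (S : measurableType d).
Variables (ev : eig_routine R S) (u : R) (n : nat) (A : 'M[R[i]]_n).
Variables (eps : R) (k : nat) (lam : n.-tuple R).

Lemma measurable_accurate delta :
  measurable [set s | accurate lam delta (sort <=%R (eig_out ev u A delta s))].
Proof.
rewrite (_ : [set s | _] = \bigcap_(i in [set: 'I_n])
    [set s | `|(sort <=%R (eig_out ev u A delta s))`_i - lam`_i| <= delta]).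
  apply: fin_bigcap_measurable; first exact: finite_finset.
  move=> i _; rewrite -[X in measurable X]setTI; apply: measurable_fun_le => //.
  apply: measurableT_comp => //; apply: measurable_funB => //.
  exact/measurable_nth_sort/measurable_eig_out.
by apply/seteqP; split => s /= acc i; [move=> _|]; exact: acc.
Qed.

Variables (dT : measure_display) (T : measurableType dT) (P : probability T R).
Variables (Q : probability S R) (seed : nat -> T -> S).
Hypothesis seedP : random_tape P Q seed.

(** The guard after call [m] compares the fixed number [2 ^- m.+1] with a function of seed [m]
    alone. *)
Lemma measurable_fermi_guard m : measurable [set w | fermi_guard eps k
  (iter m (fermi_step ev u A (fun j => seed j w))
     (fermi_init ev u A (fun j => seed j w)))].
Proof.
rewrite /fermi_guard /fermi_gap /level_gap.
under eq_set do rewrite fermi_delta_iter fermi_lam_iter.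
have mlam i : measurable_fun [set: T]
    (fun w => (sort <=%R (eig_out ev u A (2 ^- m.+1) (seed m w)))`_i).
  apply: (@measurableT_comp _ _ _ _ _ _
    (fun s => (sort <=%R (eig_out ev u A (2 ^- m.+1) s))`_i)); last exact: (seedP m).1.
  exact/measurable_nth_sort/measurable_eig_out.
have mlt : measurable_fun [set: T] (fun w => eps / (1 + 2 * eps) *
    `|(sort <=%R (eig_out ev u A (2 ^- m.+1) (seed m w)))`_k.-1 -
      (sort <=%R (eig_out ev u A (2 ^- m.+1) (seed m w)))`_k| < 2 ^- m.+1).
  apply: measurable_fun_ltr => //.
  apply: measurable_funM => //; apply: measurableT_comp => //.
  exact: measurable_funB.
by rewrite -[X in measurable X]setTI; exact: (mlt measurableT [set true]).
Qed.

Lemma measurable_fermi_success :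
  measurable [set w | fermi_success ev u A eps k (fun j => seed j w) lam].
Proof.
pose G m := [set w | fermi_guard eps k
  (iter m (fermi_step ev u A (fun j => seed j w))
     (fermi_init ev u A (fun j => seed j w)))].
pose B m := [set s | accurate lam (2 ^- m.+1) (sort <=%R (eig_out ev u A (2 ^- m.+1) s))].
(* Each implication of [fermi_successP] is written as a union: an earlier guard failed, or call [m]
   is accurate. *)
rewrite (_ : [set w | _] = \bigcap_m (~` (\bigcap_(j in `I_m) G j)
    `|` seed m @^-1` B m)).
  apply: bigcapT_measurable => m; apply: measurableU.
    apply: measurableC; apply: bigcap_measurableType => j _.
    exact: measurable_fermi_guard.
  rewrite -[X in measurable X]setTI; apply: (seedP m).1 => //.
  exact: measurable_accurate.
apply/seteqP; split => w /=.
  move=> /fermi_successP succ m _.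
  have [gm|ngm] := pselect (forall j, (j < m)%N -> G j w); last by left.
  by right; exact: succ.
move=> h; apply/fermi_successP => m gm; have [nb|//] := h m I.
by case: nb; exact: gm.
Qed.

End FermiProbability.

(** Induction on [m], by subadditivity on the complements; the events may be dependent. *)
Lemma union_bound (R : realType) (d : measure_display) (T : measurableType d)
    (P : probability T R) (E : nat -> set T) (q : R) (m : nat) :
  (forall j, measurable (E j)) ->
  (forall j, (j < m)%N -> (1 - q)%:E <= P (E j))%E ->
  ((1 - q *+ m)%:E <= P (\bigcap_(j in `I_m) E j))%E.
Proof.
move=> mE; elim: m => [|m IH] PE.
  by rewrite II0 bigcap_set0 probability_setT mulr0n subr0.
have {}IH := IH (fun j jm => PE j (leqW jm)).
have mB : measurable (\bigcap_(j in `I_m) E j) by exact: bigcap_measurableType.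
rewrite IIS bigcap_setU bigcap_set1.
have -> : \bigcap_(j in `I_m) E j `&` E m = ~` (~` (\bigcap_(j in `I_m) E j) `|` ~` E m).
  by rewrite setCU !setCK.
rewrite probability_setC; last by apply: measurableU; exact: measurableC.
have : (P (~` (\bigcap_(j in `I_m) E j) `|` ~` E m) <=
    P (~` (\bigcap_(j in `I_m) E j)) + P (~` E m))%E.
  by apply: measureU2; exact: measurableC.
rewrite !probability_setC//; have := PE m (ltnSn m); move: IH.
have : P (~` (\bigcap_(j in `I_m) E j) `|` ~` E m) \is a fin_num.
  by apply: fin_num_measure; apply: measurableU; exact: measurableC.
have : P (\bigcap_(j in `I_m) E j) \is a fin_num by exact: fin_num_measure.
have : P (E m) \is a fin_num by exact: fin_num_measure.
move=> /fineK <- /fineK <- /fineK <-.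
rewrite -!EFinB -EFinD !lee_fin mulrS; lra.
Qed.

(** * Assembly of the accuracy, cost, probability and precision bounds *)

Unset Implicit Arguments.

Theorem theorem5p1 (R : realType) (eta : R) (TMM : nat -> nat)
    (heta : 0 < eta) (hTMM : mm_cost eta TMM)
    (dS : measure_display) (S : measurableType dS) (Q : probability S R)
    (ev : eig_routine R S) (hev : EVALSH_spec TMM Q ev) :
  exists Cops Cprob Cbits : R,
  forall (n : nat) (A : 'M[R[i]]_n) (lam : n.-tuple R) (eps : R) (k : nat),
    A \is hermsymmx -> opnorm A <= 1 -> eigenvalues A lam ->
    0 < eps < 1 -> (0 < k < n)%N ->
    let mu := level_mid lam k in
    let gap := level_gap lam k in
    (forall (u : R) (tape : nat -> S) (st : fermi_state R), 0 < u ->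
       fermi_success ev u A eps k tape lam ->
       fermi_returns ev u A eps k tape st ->
       `|mu - fermi_mu k st| <= eps * gap /\
       `|gap - fermi_gap k st| <= 2 * eps * gap) /\
    (0 < gap ->
     exists2 b : nat,
       b%:R <= Cbits * logp (n%:R / (eps * gap)) ^+ 4 * ln n%:R &
     forall u : R, 0 < u <= 2 ^- b ->
       (forall tape : nat -> S, fermi_success ev u A eps k tape lam ->
          exists2 st : fermi_state R, fermi_returns ev u A eps k tape st &
          (fermi_total_ops st)%:R <=
            Cops * (TMM n)%:R * logp (n%:R / (eps * gap)) ^+ 2
                 * logp (1 / (eps * gap))) /\
       (forall (dT : measure_display) (T : measurableType dT)
               (P : probability T R) (seed : nat -> T -> S),
          random_tape P Q seed ->
          ((1 - Cprob * logp (1 / (eps * gap)) / n%:R)%:E <=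
            P [set w | fermi_success ev u A eps k (fun j => seed j w) lam])%E)).
Proof.
have [TMMn2 _] := hTMM; have [c1 [c2 spec]] := hev.
(* There are at most [11 * l] calls. The powers [10 ^ 2] and [10 ^ 4] come from [ln_le_logpM], the 3
   from sorting and the fixed charge 8, the final 1 from the two operations on exit, and
   [187 = 11 * 17]. Absolute values are taken because [c1] and [c2] have no known sign. *)
exists (11 * (100 * `|c1| + 3) + 1), 187, (10 ^+ 4 * `|c2|).
move=> n A lam eps k Aherm A1 Alam eps01 kn mu gap; split.
  by move=> u tape st _; exact: fermi_returns_accurate.
move=> gap0; have [e0 e1] := andP eps01; have [k0 ltkn] := andP kn.
have n1 : (1 < n)%N by exact: leq_ltn_trans ltkn.
have n0 : (0 < n)%N by exact: ltnW.
pose X := eps * gap; have X0 : 0 < X by rewrite mulr_gt0.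
have X2 : X <= 2.
  have lam1 i : (i < n)%N -> `|lam`_i| <= 1.
    move=> lin; apply: (le_trans (eigenvalue_le_opnorm Alam _) A1).
    by rewrite mem_nth// size_tuple.
  apply: (@le_trans _ _ gap); first by rewrite ler_piMl// ltW.
  apply: (le_trans (ler_normB _ _)).
  have := lam1 _ ltkn; have := lam1 _ (leq_ltn_trans (leq_pred k) ltkn); lra.
have X02 : 0 < X <= 2 by rewrite X0.
have [M [depthM shallowM callsM]] := halving_depth X02.
pose L := logp (n%:R / X); pose l := logp (1 / X).
have L1 : 1 <= L by exact: logp_ge1.
have l1 : 1 <= l by exact: logp_ge1.
have d01 j : 0 < (2 ^- j.+1 : R) < 1.
  by rewrite invr_gt0 exprn_gt0//= invf_lt1 ?exprn_gt0// exprn_egt1 ?ltr1n.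
have ln0 j : 0 <= ln (n%:R / 2 ^- j.+1 : R).
  by rewrite invrK ln_ge0// -natrX -natrM ler1n muln_gt0 n0 expn_gt0.
have lnL j : (j <= M)%N -> ln (n%:R / 2 ^- j.+1 : R) <= 10 * L.
  move=> jM; have /andP[dj _] := d01 j; apply: ln_le_logpM => //.
  apply: (le_trans shallowM); rewrite ler_pM2l// lef_pV2 ?posrE ?exprn_gt0//.
  by rewrite ler_weXn2l// ler1n.
have lnX p j : (j <= M)%N -> ln (n%:R / 2 ^- j.+1 : R) ^+ p <= (10 * L) ^+ p.
  by move=> jM; apply: lerXn2r; rewrite ?nnegrE ?lnL// mulr_ge0//; lra.
have {spec}/choice[b bP] : forall j, exists b : nat,
    b%:R <= c2 * ln (n%:R / 2 ^- j.+1) ^+ 4 * ln n%:R /\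
    forall (u : R), 0 < u <= 2 ^- b ->
      (forall s, (eig_ops ev u A (2 ^- j.+1) s)%:R
                   <= c1 * (TMM n)%:R * ln (n%:R / 2 ^- j.+1) ^+ 2) /\
      ((1 - 17 / n%:R)%:E <= Q [set s | accurate lam (2 ^- j.+1)
          (sort <=%R (eig_out ev u A (2 ^- j.+1) s))])%E.
  move=> j; have [b b1 b2] := spec n (2 ^- j.+1) n1 (d01 j).
  by exists b; split => // u ub; exact: b2.
(* One unit roundoff must serve all calls up to [M]. The maximum is attained at one of them, so it
   obeys the bound for a single call. *)
exists (\max_(j < M.+1) b j).
  have [j ->] := bigop.eq_bigmax (fun j : 'I_M.+1 => b j) ltac:(by rewrite card_ord).
  apply: (le_trans (bP j).1); rewrite ler_wpM2r ?ln_natr_ge0//.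
  apply: (@le_trans _ _ (`|c2| * (10 * L) ^+ 4)).
    apply: (@le_trans _ _ (`|c2| * ln (n%:R / 2 ^- j.+1) ^+ 4)).
      by rewrite ler_wpM2r ?exprn_ge0// ler_norm.
    by rewrite ler_wpM2l// lnX// -ltnS.
  by rewrite exprMn mulrA [`|c2| * _]mulrC.
move=> u /andP[u0 ub].
have {}ub j : (j <= M)%N -> 0 < u <= 2 ^- b j.
  move=> jM; rewrite u0 (le_trans ub)// lef_pV2 ?posrE ?exprn_gt0//.
  rewrite ler_weXn2l ?ler1n//.
  exact: (leq_bigmax (F := fun j : 'I_M.+1 => b j) (Ordinal (jM : (j < M.+1)%N))).
split.
  move=> tape succ.
  have [m mM ret] := fermi_success_returns eps01 kn depthM succ.
  exists (iter m (fermi_step ev u A tape) (fermi_init ev u A tape)) => //.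
  have opsc j s : (j <= m)%N ->
      (eig_ops ev u A (2 ^- j.+1) s)%:R <= `|c1| * (TMM n)%:R * (10 * L) ^+ 2.
    move=> jm; have jM := leq_trans jm mM.
    apply: (le_trans (((bP j).2 u (ub j jM)).1 s)).
    apply: (@le_trans _ _ (`|c1| * (TMM n)%:R * ln (n%:R / 2 ^- j.+1) ^+ 2)).
      by rewrite ler_wpM2r ?sqr_ge0// ler_wpM2r// ler_norm.
    by rewrite ler_wpM2l ?lnX// mulr_ge0.
  have opsm := fermi_ops_iter tape opsc.
  (* The first clause of [mm_cost] absorbs the overhead of a pass: sorting costs at most [n ^ 2],
     and [1 < n] gives [TMM n >= 4], so the charge 8 is at most [2 * TMM n]. *)
  have n2T : (n ^ 2)%:R <= (TMM n)%:R :> R by rewrite ler_nat.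
  have sortT : (n * up_log 2 n)%:R <= (TMM n)%:R :> R.
    apply: le_trans n2T; rewrite ler_nat -mulnn leq_mul2l up_log_min ?orbT//.
    exact/ltnW/ltn_expl.
  have T4 : 4 <= (TMM n)%:R :> R.
    by apply: le_trans n2T; rewrite -[4]/((2 ^ 2)%:R) ler_nat leq_exp2r.
  have TL : (TMM n)%:R <= (TMM n)%:R * L ^+ 2 by rewrite ler_peMr// exprn_ege1.
  have TLl : (TMM n)%:R * L ^+ 2 <= (TMM n)%:R * L ^+ 2 * l.
    by rewrite ler_peMr// mulr_ge0// sqr_ge0.
  have callm : `|c1| * (TMM n)%:R * (10 * L) ^+ 2 + (n * up_log 2 n)%:R + 8
      <= (100 * `|c1| + 3) * ((TMM n)%:R * L ^+ 2).
    by rewrite exprMn; lra.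
  have : m.+1%:R <= 11 * l by apply: le_trans callsM; rewrite ler_nat.
  move=> /(ler_pM _ _)/(_ callm) ml.
  rewrite /fermi_total_ops natrD.
  apply: (@le_trans _ _ (11 * l * ((100 * `|c1| + 3) * ((TMM n)%:R * L ^+ 2)) + 2)).
    rewrite lerD2r; apply: (le_trans opsm); apply: ml => //.
    by rewrite !addr_ge0// mulr_ge0 ?sqr_ge0// mulr_ge0.
  by rewrite -/X -/L -/l; lra.
move=> dT T P seed seedP.
pose good j := [set s | accurate lam (2 ^- j.+1)
  (sort <=%R (eig_out ev u A (2 ^- j.+1) s))].
have mgood j : measurable (good j) by exact: measurable_accurate.
have mseed j : measurable (seed j @^-1` good j).
  by rewrite -[X in measurable X]setTI; exact: (seedP j).1.
have Pgood j : (j < M.+1)%N ->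
    ((1 - 17 / n%:R)%:E <= P (seed j @^-1` good j))%E.
  by move=> jM; rewrite (seedP j).2//; exact: ((bP j).2 u (ub j jM)).2.
have := union_bound mseed Pgood.
(* All [M.+1] calls are required to be accurate, even those that a run stopping earlier does not
   make; this only shrinks the event. *)
have sub : \bigcap_(j in `I_M.+1) (seed j @^-1` good j) `<=`
    [set w | fermi_success ev u A eps k (fun j => seed j w) lam].
  by move=> w gw; exact: (good_fermi_success eps01 kn depthM).
have mcap : measurable (\bigcap_(j in `I_M.+1) (seed j @^-1` good j)).
  exact: bigcap_measurableType.
move=> capP; apply: le_trans (le_measure P _ _ sub); last 2 first.
- exact/mem_set.
- by apply/mem_set; apply: measurable_fermi_success; exact: seedP.
apply: le_trans capP; rewrite lee_fin lerD2l lerN2.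
rewrite -[_ *+ M.+1]mulr_natr [17 / _ * _]mulrAC.
by rewrite ler_wpM2r ?invr_ge0// -/X -/l; move: callsM; rewrite -/l; lra.
Qed.
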